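(* Let $R$ be an associative ring with identity and let $a,b,c,d\in R$ satisfy $$(ac)^2=(db)(ac),\quad (db)^2=(ac)(db),\quad b(ac)a=b(db)a,\quad c(ac)d=c(db)d.$$ Put $\alpha=1-bd$ and $\beta=1-ac$. Then $\alpha\in R^d$ if and only if $\beta\in R^d$. In this case (the inverse below existing), $$\beta^{d}=\big[1-d\alpha^{\pi}\big(1-\alpha^{\pi}\alpha (1+bd)\big)^{-1}bac\big](1+ac)+d\alpha^d bac.$$
   Context: Let $R$ be an associative ring with identity and $R^{-1}$ its set of invertible elements. For $a\in R$, $comm(a)=\{x\in R : xa=ax\}$ and $comm^2(a)=\{x\in R : xy=yx \text{ for all } y\in comm(a)\}$. Let $R^{qnil}=\{a\in R : 1+ax\in R^{-1}\text{ for every }x\in comm(a)\}$. An element $a\in R$ has a g-Drazin (generalized Drazin) inverse if there is $x\in R$ with $x=xax$, $x\in comm^2(a)$, $a-a^2x\in R^{qnil}$; such $x$ is unique if it exists and is denoted $a^d$. $R^d$ denotes the set of all g-Drazin invertible elements of $R$. For $a\in R^d$, $a^{\pi}=1-aa^d$. (The letter $d$ is also the name of one of the four given ring elements; as a superscript it always denotes the g-Drazin inverse.) *)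

(* Defs.v *)
From mathcomp Require Import all_boot all_algebra.

Set Implicit Arguments.
Unset Strict Implicit.
Unset Printing Implicit Defensive.

Import GRing.Theory.
Local Open Scope ring_scope.

(* The ring is a [pzRingType]: associative with identity, not necessarily
   commutative and possibly zero. [unitRingType] would impose [1 != 0] and a
   boolean invertibility test, so invertibility is stated relationally. *)
Definition is_inverse (R : pzRingType) (a v : R) : Prop :=
  v * a = 1 /\ a * v = 1.

Definition invertible (R : pzRingType) (a : R) : Prop :=
  exists v : R, is_inverse a v.

Definition comm1 (R : pzRingType) (a x : R) : Prop := x * a = a * x.

Definition comm2 (R : pzRingType) (a x : R) : Prop :=
  forall y : R, comm1 a y -> x * y = y * x.

Definition qnil (R : pzRingType) (a : R) : Prop :=
  forall x : R, comm1 a x -> invertible (1 + a * x).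

(* [is_gdrazin a x] reads "x = a^d". *)
Definition is_gdrazin (R : pzRingType) (a x : R) : Prop :=
  [/\ x = x * a * x, comm2 a x & qnil (a - a ^+ 2 * x)].

Definition gdrazin_invertible (R : pzRingType) (a : R) : Prop :=
  exists x : R, is_gdrazin a x.

(* Main.v *)
Require Import Defs.
From mathcomp Require Import all_boot all_algebra.

Import GRing.Theory.
Local Open Scope ring_scope.

(** Write [p = ac], [w = bd] and [q = db].  For the implication from [alpha]
    to [beta], the factors [a] and [c] occur only through [p]: what is needed is
    [qp = p^2], [pq = q^2] and [p^2 d = pqd], the relation [intertwined] below.
    Such a relation makes [b] and [d] carry the commutant of [p] to that of [w]:
    if [y] commutes with [p], then [bpyd] commutes with [w].  Consequently
    [d w^2 z bp] lies in the double commutant of [p] for every [z] in the double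
    commutant of [w] ([comm2_transfer]).

    Let [x] be the g-Drazin inverse of [1 - w] and [e = 1 - (1 - w)x] its
    spectral idempotent.  On the corner of [e] the element [1 - w] is
    quasinilpotent, so [w] is invertible there, and [u = ev] is the inverse of
    [w^2] in that corner, since [1 - e(1 - w)(1 + w) = 1 - e + e w^2].  The
    idempotent of [1 - p] is then [F = d u bp].  Where [F] vanishes, the inverse
    of [1 - p] is the Jacobson-type expression [1 + p + d x bp], whence the
    formula [(1 - F)(1 + p) + d x bp].  The part [(1 - p)F] equals [d n u bp] with
    [n = e(1 - w)], and [bp] and [d] intertwine it with [n]; quasinilpotency
    passes from [n] to it because [1 + st] and [1 + ts] are simultaneously
    invertible ([qnil_transfer]).

    The implication from [beta] to [alpha] is three instances of the first one,
    through [1 - ac], [1 - ca], [1 - db], [1 - bd]: exchanging [(a, c)] with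
    [(d, b)] preserves the hypotheses, and the outer two steps are the pairs
    [(st, ts)].  The formula for an arbitrary g-Drazin inverse of [beta] follows
    by uniqueness ([gdrazin_unique]). *)

(** * Double commutants *)

Lemma comm2_self {R : pzRingType} {a : R} : comm2 a a.
Proof. by move=> y ->. Qed.

Lemma comm2_one {R : pzRingType} {a : R} : comm2 a 1.
Proof. by move=> y _; rewrite mul1r mulr1. Qed.

Lemma comm2D {R : pzRingType} {a x y : R} :
  comm2 a x -> comm2 a y -> comm2 a (x + y).
Proof. by move=> hx hy z hz; rewrite mulrDl mulrDr hx // hy. Qed.

Lemma comm2B {R : pzRingType} {a x y : R} :
  comm2 a x -> comm2 a y -> comm2 a (x - y).
Proof. by move=> hx hy z hz; rewrite mulrBl mulrBr hx // hy. Qed.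

Lemma comm2M {R : pzRingType} {a x y : R} :
  comm2 a x -> comm2 a y -> comm2 a (x * y).
Proof. by move=> hx hy z hz; rewrite -mulrA hy // mulrA hx // mulrA. Qed.

Lemma comm2_inverse {R : pzRingType} {a x v : R} :
  comm2 a x -> is_inverse x v -> comm2 a v.
Proof.
move=> hx [vx xv] y hy.
by rewrite -[LHS]mulr1 -xv mulrA -(mulrA v y x) -hx // !mulrA vx mul1r.
Qed.

Lemma comm1_one_sub {R : pzRingType} {a y : R} :
  comm1 (1 - a) y <-> comm1 a y.
Proof.
rewrite /comm1 mulrBr mulrBl mulr1 mul1r; split=> [h|-> //].
by apply: oppr_inj; apply: (addrI y).
Qed.

Lemma comm2_one_sub {R : pzRingType} {a x : R} :
  comm2 (1 - a) x <-> comm2 a x.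
Proof. by split=> h y hy; apply: h; apply/comm1_one_sub. Qed.

(** * Quasinilpotents and uniqueness of the g-Drazin inverse *)

Lemma invertible_swap {R : pzRingType} {x y : R} :
  invertible (1 + x * y) -> invertible (1 + y * x).
Proof.
case=> v []; rewrite mulrDr mulrDl mul1r mulr1 => vl vr.
have {}vl : v * (x * y) = 1 - v by rewrite -vl addrC addKr.
have {}vr : x * y * v = 1 - v by rewrite -vr addrC addKr.
exists (1 - y * v * x); split.
- rewrite mulrDr mulr1 mulrBl mul1r.
  have -> : y * v * x * (y * x) = y * (v * (x * y)) * x by rewrite !mulrA.
  by rewrite vl mulrBr mulr1 mulrBl subKr subrK.
- rewrite mulrDl mul1r mulrBr mulr1.
  have -> : y * x * (y * v * x) = y * (x * y * v) * x by rewrite !mulrA.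
  by rewrite vr mulrBr mulr1 mulrBl subKr subrK.
Qed.

(** If [z] commutes with [N], then [gzd] commutes with [n], and so does [v gzd].
    The quasinilpotency of [n] thus applies to [1 + n v gzd], which is [1 + Nz]
    with its factor [d] moved to the end. *)
Lemma qnil_transfer {R : pzRingType} {n v g d N : R} :
  qnil n -> comm2 n v -> N = d * (n * v * g) ->
  g * N = n * g -> N * d = d * n -> qnil N.
Proof.
move=> hn hv NE gN Nd z hz.
have hs : comm1 n (g * z * d).
  by rewrite /comm1 -mulrA -Nd (mulrA (g * z)) -(mulrA g z N) hz !mulrA gN.
rewrite NE -mulrA; apply: invertible_swap.
have -> : n * v * g * z * d = n * (v * (g * z * d)) by rewrite !mulrA.
apply: hn; rewrite /comm1 -mulrA hs !mulrA; congr (_ * _ * _ * _).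
exact: hv.
Qed.

Lemma gdrazin_comm {R : pzRingType} {a x : R} :
  is_gdrazin a x -> x * a = a * x.
Proof. by case=> _ h _; apply: h. Qed.

(** [ax(1 - ay)] is an idempotent of the form [nx] with [n] quasinilpotent and
    [x] in its commutant; as [1 - nx] is invertible, the idempotent is zero. *)
Lemma gdrazin_idem_le {R : pzRingType} {a x y : R} :
  is_gdrazin a x -> is_gdrazin a y -> a * x = a * x * (a * y).
Proof.
move=> gx gy; have xa := gdrazin_comm gx; have ya := gdrazin_comm gy.
case: gx gy => xE xc _ [yE yc qy].
have xy : x * y = y * x by apply: xc.
have nE : a - a ^+ 2 * y = a * (1 - a * y) by rewrite mulrBr mulr1 mulrA expr2.
move: qy; rewrite nE => qy.
have xf : x * (1 - a * y) = (1 - a * y) * x.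
  by rewrite mulrBr mulrBl mulr1 mul1r mulrA xa -mulrA xy mulrA.
have af : a * (1 - a * y) = (1 - a * y) * a.
  by rewrite mulrBr mulrBl mulr1 mul1r -ya mulrA -ya.
have ff : (1 - a * y) * (1 - a * y) = 1 - a * y.
  rewrite mulrBr mulr1 mulrBl mul1r.
  have -> : a * y * (a * y) = a * y by rewrite -mulrA (mulrA y) -yE.
  by rewrite subrr subr0.
have ee : a * x * (a * x) = a * x by rewrite -mulrA (mulrA x) -xE.
have cx : comm1 (a * (1 - a * y)) (- x).
  by rewrite /comm1 mulNr mulrN mulrA xa -mulrA xf mulrA.
have [v [_ vr]] := qy _ cx.
have gE : a * (1 - a * y) * x = a * x * (1 - a * y) by rewrite -mulrA -xf mulrA.
have ef : (1 - a * y) * (a * x) = a * x * (1 - a * y) by rewrite mulrA -af gE.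
have gg : a * x * (1 - a * y) * (a * x * (1 - a * y)) = a * x * (1 - a * y).
  by rewrite -mulrA (mulrA (1 - _)) ef -(mulrA (a * x)) ff mulrA ee.
have : a * x * (1 - a * y) = 0.
  move: gg vr; rewrite mulrN gE; move: (a * x * _) => g gg vr.
  by rewrite -[LHS]mulr1 -vr mulrA mulrBr mulr1 gg subrr mul0r.
by rewrite mulrBr mulr1 => /eqP; rewrite subr_eq0 => /eqP.
Qed.

Lemma gdrazin_unique {R : pzRingType} {a x y : R} :
  is_gdrazin a x -> is_gdrazin a y -> x = y.
Proof.
move=> gx gy; have xa := gdrazin_comm gx; have ya := gdrazin_comm gy.
have h1 := gdrazin_idem_le gx gy; have h2 := gdrazin_idem_le gy gx.
case: gx gy => xE xc _ [yE yc _].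
have xy : x * y = y * x by apply: xc.
have ef : a * x = a * y.
  rewrite h1 [RHS]h2 -!mulrA; congr (_ * _).
  by rewrite (mulrA x) xa (mulrA y) ya -!mulrA xy.
by rewrite xE -mulrA ef mulrA xa ef -ya -yE.
Qed.

(** * The spectral idempotent of 1 - w *)

(** With [n = e(1 - w)] one has [n(1 + w) = 2n - n^2], because [nw = n - n^2];
    so [1 - n(1 + w)] is an expression in [n] alone. *)
Lemma spectral_square {R : pzRingType} {w x : R} :
  is_gdrazin (1 - w) x ->
  let e := 1 - (1 - w) * x in
  let n := e * (1 - w) in
  [/\ e * e = e, e * x = 0, e * w = w * e, qnil n & n * w = n - n * n].
Proof.
move=> gx e n; have xa := gdrazin_comm gx; case: gx => xE _ qx.
have [ea ex ee] : [/\ e * (1 - w) = (1 - w) * e, e * x = 0 & e * e = e].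
  rewrite /e; move: (1 - w) xa xE => A xa xE.
  have ex : (1 - A * x) * x = 0 by rewrite mulrBl mul1r -xa -xE subrr.
  split=> //; first by rewrite mulrBl mulrBr mul1r mulr1 -mulrA xa.
  by rewrite [LHS]mulrBr mulr1 -{3}xa mulrA ex mul0r subr0.
have ew : e * w = w * e by apply/comm1_one_sub.
have qn : qnil n.
  suff -> : n = 1 - w - (1 - w) ^+ 2 * x by [].
  by rewrite /n ea /e mulrBr mulr1 mulrA expr2.
have nn : n * n = n * (1 - w) by rewrite {2}/n mulrA /n -(mulrA e) -ea mulrA ee.
by split=> //; rewrite nn mulrBr mulr1 subKr.
Qed.

Lemma spectral_inverse_exists {R : pzRingType} {w x : R} :
  is_gdrazin (1 - w) x ->
  exists v, is_inverse (1 - (1 - (1 - w) * x) * (1 - w) * (1 + w)) v.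
Proof.
move=> gx; have [_ _ ew qn _] := spectral_square gx; move: ew qn => /=.
move: (1 - (1 - w) * x) => e ew qn.
rewrite -mulrN; apply: qn; rewrite /comm1 mulNr [RHS]mulrN; congr (- _).
have wn : w * (e * (1 - w)) = e * (1 - w) * w.
  by rewrite mulrA -ew -!mulrA [in LHS]mulrBr [in RHS]mulrBl mulr1 mul1r.
by rewrite [LHS]mulrDl [RHS]mulrDr mul1r mulr1 wn.
Qed.

(** Since [e(1 - n(1 + w)) = e - e(1 - w^2) = ew^2], the element [v] inverts [w^2]
    on the corner of [e].  It lies in the double commutant of [n], not only in
    that of [w], because [n(1 + w) = 2n - n^2]; an element that commutes with [n]
    need not commute with [w], and [qnil_transfer] concerns such elements. *)
Lemma spectral_corner {R : pzRingType} {w x v : R} :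
  is_gdrazin (1 - w) x ->
  let e := 1 - (1 - w) * x in
  let n := e * (1 - w) in
  is_inverse (1 - n * (1 + w)) v ->
  [/\ comm2 n v, comm2 w v & e * v * w * w = e].
Proof.
move=> gx e n hv; have [ee ex ew qn nw] := spectral_square gx.
have cw : comm2 w e.
  case: gx => _ /comm2_one_sub cx _.
  apply: comm2B; first exact: comm2_one.
  by apply: comm2M cx; apply: comm2B; [exact: comm2_one | exact: comm2_self].
have vw : comm2 w v.
  apply: comm2_inverse hv; apply: comm2B; first exact: comm2_one.
  apply: comm2M; first apply: comm2M => //.
    by apply: comm2B; [exact: comm2_one | exact: comm2_self].
  by apply: comm2D; [exact: comm2_one | exact: comm2_self].
split=> //.
  apply: comm2_inverse hv; rewrite mulrDr mulr1 nw.
  have cn := @comm2_self R n.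
  apply: comm2B; first exact: comm2_one.
  apply: comm2D => //; apply: comm2B => //; exact: comm2M.
have en : e * n = n by rewrite /n mulrA ee.
have enw : e * (1 - n * (1 + w)) = e * w * w.
  rewrite mulrBr mulr1 (mulrA e) en /n -(mulrA e)
    (_ : (1 - w) * (1 + w) = 1 - w * w).
    by rewrite mulrBr mulr1 subKr mulrA.
  by rewrite mulrBl mulrDr mulrDr !mul1r !mulr1 opprD addrA addrK.
case: hv => _ hv.
have vc : v * w = w * v by apply: vw.
by rewrite -!mulrA (mulrA v) vc -!mulrA vc !mulrA -enw -mulrA hv mulr1.
Qed.

(** * Transfer of the double commutant *)

(** With [q = db] these equations read [qp = p^2], [pq = q^2] and [p^2 d = pqd]. *)
Definition intertwined {R : pzRingType} (p b d : R) : Prop :=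
  [/\ d * b * p = p * p, p * d * b = d * b * d * b & p * p * d = p * d * b * d].

Lemma intertwined_eqs {R : pzRingType} {p b d w : R} :
  intertwined p b d -> w = b * d ->
  [/\ p * d * w = d * w * w, p * p * d = d * w * w, b * p * p = w * b * p
    & w * b * p * d = w * w * w].
Proof.
move=> [h1 h2 h4] ->.
have e1 : p * d * (b * d) = d * (b * d) * (b * d) by rewrite !mulrA h2.
have e2 : p * p * d = d * (b * d) * (b * d) by rewrite h4 h2 !mulrA.
have e3 : b * p * p = b * d * b * p by rewrite -mulrA -h1 !mulrA.
by split=> //; rewrite -e3 -!mulrA (mulrA p p) e2 !mulrA.
Qed.

(** If [y] commutes with [p], then [bpyd] commutes with [w = bd], hence with
    [x]; the remaining powers of [w] serve to turn [p] into [db] and back. *)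
Lemma comm2_transfer {R : pzRingType} {p b d w x : R} :
  intertwined p b d -> w = b * d -> comm2 w x ->
  comm2 p (d * w * w * x * b * p).
Proof.
move=> hI wE cx y hy; have [e1 e2 e3 e4] := intertwined_eqs hI wE.
case: hI => h1 h2 _.
have wx : w * x = x * w by rewrite (cx w).
have yp z : y * (p * z) = p * (y * z) by rewrite !mulrA hy.
have cy : comm1 w (b * p * y * d).
  rewrite /comm1 !mulrA -e3.
  have -> : b * p * p * y * d = b * y * (p * p * d) by rewrite -!mulrA yp yp.
  by rewrite e2 -e1 !mulrA -(mulrA b y) hy !mulrA.
have e3w : w * b * p * p = w * w * b * p.
  by rewrite -(mulrA w b) -(mulrA w) e3 !mulrA.
(* [x] passes across [b * p * y * d] and leaves [y] on the right of [b * p];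
   grouped with [d] on the left instead, the same factor becomes [y * p * p * d]. *)
transitivity (d * (b * p * y * d) * x * b * p).
  rewrite -(mulrA d _ x) -(cx _ cy).
  have -> : d * (x * (b * p * y * d)) * b * p
          = d * x * (b * p * y * (d * b * p)).
    by rewrite !mulrA.
  have -> : b * p * y * (d * b * p) = w * w * b * p * y.
    by rewrite h1 -!mulrA yp hy !mulrA e3 e3w.
  by rewrite !mulrA -(mulrA d x) -wx mulrA -(mulrA (d * w) x) -wx !mulrA.
have -> : d * (b * p * y * d) = y * (d * w * w).
  by rewrite -e2 !mulrA h1 -(mulrA p p) -hy mulrA -hy.
by rewrite !mulrA.
Qed.

(** * The g-Drazin inverse of 1 - p *)

(** With [u = ev] the inverse of [w^2] in the corner of [e], the g-Drazin
    inverse [x] of [1 - w] expands as [1 + w + w^2 z], and [e = w^2 u].  This is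
    the form to which [comm2_transfer] applies, and it also shows that [pdxb]
    equals [dwxb], since [pdb = dwb] and [pdw = dw^2]. *)
Lemma gdrazin_intertwined {R : pzRingType} {p b d x v : R} :
  intertwined p b d ->
  is_gdrazin (1 - b * d) x ->
  let e := 1 - (1 - b * d) * x in
  is_inverse (1 - e * (1 - b * d) * (1 + b * d)) v ->
  is_gdrazin (1 - p) ((1 - d * e * v * b * p) * (1 + p) + d * x * b * p).
Proof.
move=> hI; move wE: (b * d) => w gx e hv; move/esym: wE => wE.
have [e1 e2 e3 e4] := intertwined_eqs hI wE.
have [ee ex ew qn nw] := spectral_square gx.
have [vn vw uww] := spectral_corner gx hv.
have cx : comm2 w x by case: gx => _ /comm2_one_sub.
have cw : comm2 w w := comm2_self.
have ce : comm2 w e.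
  apply: comm2B; first exact: comm2_one.
  by apply: comm2M cx; apply: comm2B cw; exact: comm2_one.
have ax : (1 - w) * x = 1 - e by rewrite /e subKr.
move: ee ex ew qn nw vn uww ce ax; rewrite -/e.
clearbody e => /= ee ex ew qn nw vn uww ce ax.
have [h1 h2 h4] := hI.
pose u := e * v.
have cu : comm2 w u by apply: comm2M.
have uw : u * w = w * u by apply: cu.
have eu : e * u = u by rewrite /u mulrA ee.
have uc : u * e = u by rewrite -(ce u).
have uww1 : u * w * w = e by [].
have eE : w * w * u = e by rewrite -mulrA -uw mulrA -uw.
have [t ct tE] : exists2 t, comm2 w t & w * w * t = u.
  by exists (u * v); [exact: comm2M | rewrite mulrA eE].
have nv : e * (1 - w) * v = u * (1 - w).
  rewrite /u -!mulrA; congr (_ * _).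
  by rewrite mulrBl mulrBr mul1r mulr1 (vw w).
have -> : d * e * v * b * p = d * u * b * p by rewrite /u !mulrA.
clearbody u.
have [z cz xE] : exists2 z, comm2 w z & x = 1 + w + w * w * z.
  pose s := x - w * u; exists (s - u).
    by apply: comm2B => //; apply: comm2B => //; exact: comm2M.
  have x1 : x = 1 + w * s.
    by rewrite /s mulrBr mulrA eE addrA addrAC -ax mulrBl mul1r subrK.
  have s1 : s = 1 + w * (s - u) by rewrite [w * _]mulrBr addrA -x1.
  by rewrite {1}x1 {1}s1 [w * _]mulrDr mulr1 mulrA addrA.
have cp : comm2 p p := comm2_self.
have cT s : comm2 w s -> comm2 p (d * (w * w * s) * b * p).
  by move=> cs; rewrite !mulrA; exact: comm2_transfer hI wE cs.
have pdb : p * d * b = d * w * b by rewrite h2 wE !mulrA.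
have pdw s : p * d * (w * s) = d * w * (w * s) by rewrite !mulrA e1.
have pdu : p * d * u = d * w * u by rewrite -tE -(mulrA w w) pdw.
have pdx : p * d * x * b = d * w * x * b.
  by rewrite xE !mulrDr !mulr1 !mulrDl pdb e1 -(mulrA w w) pdw.
have bpdu : b * p * d * u = e.
  by rewrite -(mulrA b p) -(mulrA b) pdu !mulrA -wE eE.
have ubpd : u * b * p * d = e.
  have -> : u = t * (w * w) by rewrite -tE ct // /comm1 !mulrA.
  have -> : t * (w * w) * b * p * d = t * w * (w * b * p * d) by rewrite !mulrA.
  rewrite e4 -eE -tE (_ : t * w * _ = t * (w * w * w * w)) ?mulrA //.
  by rewrite -!mulrA [LHS]ct /comm1 ?mulrA.
have cX : comm2 p (d * x * b * p).
  have dwbp : d * w * b * p = p * p * p.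
    have -> : d * w * b * p = d * b * (d * b * p) by rewrite wE !mulrA.
    by rewrite h1 mulrA h1.
  have -> : d * x * b * p = p * p + p * p * p + d * (w * w * z) * b * p.
    by rewrite xE !mulrDr !mulr1 !mulrDl h1 dwbp.
  by apply: comm2D (cT _ cz); apply: comm2D; do !apply: comm2M.
pose F := d * u * b * p; have FE : F = d * u * b * p by [].
have cF : comm2 p F by rewrite FE -tE; exact: cT.
rewrite -FE; clearbody F.
have Fp : F * p = p * F by apply: cF.
have bpF : b * p * F = e * b * p by rewrite FE !mulrA bpdu.
have FF : F * F = F.
  have -> : F * F = d * u * (b * p * F) by rewrite {1}FE !mulrA.
  by rewrite bpF !mulrA -(mulrA d) uc.
have XF : d * x * b * p * F = 0.
  have -> : d * x * b * p * F = d * x * (b * p * F) by rewrite !mulrA.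
  have xe : x * e = 0 by rewrite -(ce x) //; exact: cx.
  by rewrite bpF !mulrA -(mulrA d) xe mulr0 !mul0r.
have Fpp : F * p * p = d * e * b * p.
  have -> : F * p * p = d * u * (b * p * p * p) by rewrite FE !mulrA.
  by rewrite e3 -(mulrA w b) -(mulrA w) e3 !mulrA -(mulrA d u) -(mulrA d) uww1.
have aX : (1 - p) * (d * x * b * p) = p * p - F * p * p.
  have -> : (1 - p) * (d * x * b * p) = d * ((1 - w) * x) * b * p.
    rewrite [LHS]mulrBl mul1r !mulrA pdx [d * (1 - w)]mulrBr mulr1.
    by rewrite !mulrBl.
  by rewrite ax mulrBr mulr1 !mulrBl h1 Fpp.
set B := _ + d * x * b * p.
have aB : (1 - p) * B = 1 - F.
  have c1 : (1 - F) * (1 - p) = (1 - p) * (1 - F).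
    by apply/comm1_one_sub; rewrite /comm1 mulrBl mulrBr mul1r mulr1 Fp.
  have c2 : (1 - p) * (1 + p) = 1 - p * p.
    by rewrite mulrBl !mulrDr !mul1r !mulr1 opprD addrA addrK.
  rewrite [LHS]mulrDr aX mulrA -c1 -(mulrA (1 - F)) c2.
  by rewrite [_ * (1 - p * p)]mulrBr mulr1 [_ * (p * p)]mulrBl mul1r mulrA subrK.
have cB : comm2 p B.
  apply: comm2D => //; apply: comm2M.
    by apply: comm2B => //; exact: comm2_one.
  by apply: comm2D => //; exact: comm2_one.
have BF : B * F = 0.
  have pF : (1 + p) * F = F * (1 + p) by rewrite mulrDl mulrDr mul1r mulr1 Fp.
  by rewrite mulrDl XF addr0 -mulrA pF mulrA mulrBl mul1r FF subrr mul0r.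
have Ba : B * (1 - p) = (1 - p) * B.
  by apply: cB; apply/comm1_one_sub.
split.
- by rewrite -mulrA aB mulrBr mulr1 BF subr0.
- exact/comm2_one_sub.
have -> : 1 - p - (1 - p) ^+ 2 * B = (1 - p) * F.
  by rewrite expr2 -mulrA aB [_ * (1 - F)]mulrBr mulr1 subKr.
have dN : (1 - p) * F = d * (u * (1 - w)) * b * p.
  rewrite [LHS]mulrBl mul1r FE !mulrA pdu -(mulrA d w) -uw.
  by rewrite [d * u * (1 - w)]mulrBr mulr1 !mulrBl mulrA.
(* [b * p] and [d] intertwine [(1 - p) * F] with [e * (1 - w)] because
   [b * p * d * u] and [u * b * p * d] are both the unit [e] of the corner. *)
apply: (qnil_transfer (g := b * p) (d := d) qn vn).
- by rewrite dN nv !mulrA.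
- by rewrite dN !mulrA bpdu.
- have c3 : u * (1 - w) = (1 - w) * u by rewrite mulrBl mulrBr mul1r mulr1 uw.
  rewrite dN c3 -!mulrA; congr (_ * _).
  have -> : u * (b * (p * d)) = e by rewrite !mulrA ubpd.
  by rewrite mulrBl mulrBr mul1r mulr1 ew.
Qed.

Lemma gdrazin_invertible_intertwined {R : pzRingType} {p b d : R} :
  intertwined p b d ->
  gdrazin_invertible (1 - b * d) -> gdrazin_invertible (1 - p).
Proof.
move=> hI [x gx]; have [v hv] := spectral_inverse_exists gx.
by eexists; apply: gdrazin_intertwined hI gx hv.
Qed.

(** The elements [p = ts], [b = s], [d = t] are intertwined. *)
Lemma gdrazin_invertible_swap {R : pzRingType} {s t : R} :
  gdrazin_invertible (1 - s * t) -> gdrazin_invertible (1 - t * s).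
Proof.
by apply: gdrazin_invertible_intertwined; split; rewrite ?mulrA.
Qed.

Theorem theorem2p1 (R : pzRingType) (a b c d : R)
  (h1 : (a * c) ^+ 2 = (d * b) * (a * c))
  (h2 : (d * b) ^+ 2 = (a * c) * (d * b))
  (h3 : b * (a * c) * a = b * (d * b) * a)
  (h4 : c * (a * c) * d = c * (d * b) * d) :
  let alpha := 1 - b * d in
  let beta := 1 - a * c in
  (gdrazin_invertible alpha <-> gdrazin_invertible beta) /\
  (forall alphad betad : R,
     is_gdrazin alpha alphad -> is_gdrazin beta betad ->
     let alphapi := 1 - alpha * alphad in
     exists2 v : R,
       is_inverse (1 - alphapi * alpha * (1 + b * d)) v &
       betad = (1 - d * alphapi * v * b * a * c) * (1 + a * c)
               + d * alphad * b * a * c).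
Proof.
move=> alpha beta.
have h14 : intertwined (a * c) b d.
  split; first by rewrite -h1 expr2.
    by rewrite -mulrA -h2 expr2 !mulrA.
  by have /(congr1 ( *%R a)) := h4; rewrite !mulrA.
have h23 : intertwined (d * b) c a.
  split; first by rewrite -h2 expr2.
    by rewrite -mulrA -h1 expr2 !mulrA.
  by have /(congr1 ( *%R d)) := h3; rewrite !mulrA => ->.
split.
  split; first exact: gdrazin_invertible_intertwined.
  move=> /gdrazin_invertible_swap /(gdrazin_invertible_intertwined h23).
  exact: gdrazin_invertible_swap.
move=> x y gx gy alphapi; have [v hv] := spectral_inverse_exists gx.
exists v => //; apply: (gdrazin_unique gy).
by have := gdrazin_intertwined h14 gx hv; rewrite !mulrA.
Qed.
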